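(* Let $K$ be a field and $p$ a prime number distinct from the characteristic of $K$. If $p=2$, assume that $i=\sqrt{-1}\in K$. Let $s\ge r\ge 1$ be integers. If $\alpha\in K$ is a $p^s$-th power in $K(\zeta_{p^r})$, then $\alpha$ is a $p^s$-th power in $K$. In symbols: $K(\zeta_{p^r})^{p^s}\cap K=K^{p^s}$.
   Context: $\zeta_m$ denotes a primitive $m$-th root of unity in a fixed algebraic closure of $K$. For a field $F$ and positive integer $n$, $F^n=\{\beta^n:\beta\in F\}$. *)

(* Defs.v *)
From mathcomp Require Import all_boot all_algebra.
From mathcomp Require Import boolp classical_sets.

Set Implicit Arguments.
Unset Strict Implicit.
Unset Printing Implicit Defensive.

Import GRing.Theory.

Local Open Scope ring_scope.
Local Open Scope classical_set_scope.

Definition is_subfield (L : fieldType) (F : set L) : Prop :=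
  GRing.divring_closed [pred x in F].

(* K(a) as a subset of L, where iota embeds K in L. *)
Definition adjoin (K L : fieldType) (iota : {rmorphism K -> L}) (a : L) :
  set L := smallest (@is_subfield L) (range iota `|` [set a]).

(* F^n = {b^n : b in F}. *)
Definition powers (L : fieldType) (F : set L) (n : nat) : set L :=
  [set b ^+ n | b in F].

Definition is_algebraic_closure (K : fieldType) (L : closedFieldType)
    (iota : {rmorphism K -> L}) : Prop :=
  forall x : L, algebraicOver iota x.

(* Main.v *)
Require Import Defs.
From mathcomp Require Import all_boot all_algebra.
From mathcomp Require Import boolp classical_sets.
From mathcomp Require Import fieldext.

(* Climb down the tower K(zeta_{p^r}) > ... > K(zeta_p) > K.

   Bottom step: b in K(zeta_p) is killed by a polynomial over K of degree k
   with 0 < k < p. If b^(p^s) = a, taking the gcd with X^(p^s) - a, all roots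
   have p^s-th power a, so the constant term gives c in K with c^(p^s) = a^k,
   and k is prime to p.

   Other steps: z is a primitive p^(r+1)-th root of unity, r >= 1, with w = z^p
   in K and z not in K. The same constant term argument shows that X^p - w is
   irreducible, so z -> eps z, with eps = z^(p^r) in K, induces an automorphism
   sigma of K(z) over K. If b^(p^s) = a then xi = sigma(b)/b is a root of unity
   of norm 1. Its order divides p^(r+1), as otherwise the norm of some power of
   xi would make w a p-th power in K (for p = 2 the sign in N(z) = -w is
   absorbed by the square root of -1). Hence xi = z^j, and norm 1 forces
   xi = eps^l = sigma(z^l)/z^l, so b/z^l lies in K, and its p^s-th power is a
   because r < s. *)

Set Implicit Arguments.
Unset Strict Implicit.
Unset Printing Implicit Defensive.

Import GRing.Theory.

Local Open Scope ring_scope.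

(** * Roots of low degree and constant terms *)

(** Bezout: with [u * k = v * n + 1], the element [c ^+ u / a ^+ v] has [n]-th power
    [a ^+ (k * u - v * n) = a]. *)
Lemma coprime_exp_root (F : fieldType) (a c : F) (k n : nat) :
  (0 < k)%N -> (0 < n)%N -> coprime k n -> c ^+ n = a ^+ k ->
  exists d : F, d ^+ n = a.
Proof.
move=> k_gt0 n_gt0 co_kn c_n.
have [-> | a_neq0] := eqVneq a 0; first by exists 0; rewrite expr0n gtn_eqF.
case: (egcdnP n k_gt0) => u v; rewrite (eqP co_kn) => uv _.
exists (c ^+ u / a ^+ v).
rewrite expr_div_n -exprM mulnC exprM c_n -!exprM [(k * u)%N]mulnC uv.
by rewrite exprD expr1 mulrAC divff ?mul1r // expf_neq0.
Qed.

(* The product of the k < p roots of a factor of 'X^n - a has n-th power a^k. *)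
Lemma low_degree_root_power (K : fieldType) (L : closedFieldType)
    (iota : {rmorphism K -> L}) (p s : nat) (a : K) (b : L) (q : {poly K}) :
  prime p -> b ^+ (p ^ s) = iota a -> q != 0 -> (size q <= p)%N ->
  root (map_poly iota q) b -> exists d : K, d ^+ (p ^ s) = a.
Proof.
move=> p_pr b_n q_neq0 sz_q qb0; set n := (p ^ s)%N in b_n *.
have n_gt0 : (0 < n)%N by rewrite expn_gt0 prime_gt0.
pose g := gcdp q ('X^n - a%:P).
have g_neq0 : g != 0 by rewrite gcdp_eq0 negb_and q_neq0.
have map_Xna : map_poly iota ('X^n - a%:P) = 'X^n - (iota a)%:P.
  by rewrite rmorphB /= map_polyXn map_polyC.
have gb0 : root (map_poly iota g) b.
  rewrite gcdp_map root_gcd qb0 map_Xna.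
  by rewrite /root !hornerE b_n subrr.
have [rs Drs] := closed_field_poly_normal (map_poly iota g).
have lc_neq0 : lead_coef (map_poly iota g) != 0.
  by rewrite lead_coef_eq0 map_poly_eq0.
have sz_rs : size g = (size rs).+1.
  by rewrite -(size_map_poly iota) Drs size_scale // size_prod_XsubC.
have rs_n z : z \in rs -> z ^+ n = iota a.
  move=> rs_z; have: root (map_poly iota ('X^n - a%:P)) z.
    have: root (map_poly iota g) z by rewrite Drs rootZ // root_prod_XsubC.
    by rewrite gcdp_map root_gcd => /andP[].
  by rewrite map_Xna /root !hornerE subr_eq0 => /eqP.
have prod_n : (\prod_(z <- rs) z) ^+ n = iota (a ^+ size rs).
  rewrite -prodrXl big_seq (eq_bigr (fun=> iota a)) // -big_seq.
  by rewrite big_const_seq count_predT iter_mulr_1 rmorphXn.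
(* By Vieta, this is the product of the roots of [g], written with coefficients in [K]. *)
pose c : K := (-1) ^+ size rs * (g`_0 / lead_coef g).
have Dc : iota c = \prod_(z <- rs) z.
  rewrite rmorphM rmorphXn rmorphN1 fmorph_div -lead_coef_map -coef_map.
  rewrite [in X in X / _]Drs coefZ mulrAC divff // mul1r -horner_coef0.
  rewrite horner_prod.
  rewrite (eq_bigr (fun z => -1 * z)); last first.
    by move=> z _; rewrite !hornerE mulN1r.
  rewrite big_split /= big_const_seq count_predT iter_mulr_1 mulrA.
  by rewrite -expr2 sqrr_sign mul1r.
have c_n : c ^+ n = a ^+ size rs.
  by apply: (fmorph_inj iota); rewrite -prod_n -Dc rmorphXn.
have rs_gt0 : (0 < size rs)%N.
  rewrite -ltnS -sz_rs -(size_map_poly iota).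
  by rewrite (root_size_gt1 _ gb0) // map_poly_eq0.
apply: (coprime_exp_root rs_gt0 n_gt0 _ c_n).
apply: coprimeXr; rewrite coprime_sym prime_coprime // gtnNdvd //.
by rewrite -sz_rs (leq_trans _ sz_q) // dvdp_leq // dvdp_gcdl.
Qed.


(** * Values of polynomials at an algebraic element *)

Lemma horner_map_modp (K L : fieldType) (iota : {rmorphism K -> L})
    (z : L) (m f : {poly K}) :
  root (map_poly iota m) z ->
  (map_poly iota (f %% m)).[z] = (map_poly iota f).[z].
Proof.
move=> /rootP mz0; rewrite [in RHS](divp_eq f m) rmorphD rmorphM /= !hornerE.
by rewrite mz0 mulr0 add0r.
Qed.

(** The [d] powers [f ^+ i], [i < d], reduced modulo [m] lie in a space of dimension [d - 1]. A
    linear relation among them, found as a kernel row of [A], gives the coefficients of [q]. *)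
Lemma poly_value_annihilator (K L : fieldType) (iota : {rmorphism K -> L})
    (z : L) (m f : {poly K}) :
  (1 < size m)%N -> root (map_poly iota m) z ->
  exists q : {poly K}, [/\ q != 0, (size q <= size m)%N &
    root (map_poly iota q) (map_poly iota f).[z]].
Proof.
move=> sz_m mz0; set d := size m.
pose A : 'M[K]_(d, d.-1) := \matrix_(i < d) poly_rV ((f ^+ i) %% m).
have m_neq0 : m != 0 by rewrite -size_poly_gt0 ltnW.
have : kermx A != 0.
  rewrite kermx_eq0 /row_free; apply/eqP => rkA.
  by have := rank_leq_col A; rewrite rkA -ltnS prednK ?ltnn // ltnW.
case/rowV0Pn => u /sub_kermxP uA0 u_neq0.
exists (rVpoly u); split; last 1 first.
- have := congr1 (fun v => (map_poly iota (rVpoly v)).[z]) uA0.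
  rewrite !linear0 horner0 mulmx_sum_row !linear_sum /= horner_sum => sum0.
  apply/rootP; rewrite -[RHS]sum0 (horner_coef_wide (n := d)); last first.
    by rewrite size_map_poly size_poly.
  apply: eq_bigr => i _; rewrite linearZ /= map_polyZ hornerZ coef_map.
  rewrite coef_rVpoly_ord; congr (_ * _).
  rewrite rowK poly_rV_K; last by rewrite -ltnS prednK ?ltn_modp // ltnW.
  by rewrite horner_map_modp // rmorphXn /= horner_exp.
- by apply: contra_neq u_neq0 => u0; rewrite -[u]rVpolyK u0 linear0.
- exact: size_poly.
Qed.

Lemma coef_comp_scaleX (R : comNzRingType) (f : {poly R}) (c : R) (i : nat) :
  (f \Po (c *: 'X))`_i = c ^+ i * f`_i.
Proof.
rewrite coef_comp_poly.
under eq_bigr => j _ do rewrite exprZn coefZ coefXn.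
case: (ltnP i (size f)) => [lt_i | ge_i]; last first.
  rewrite nth_default // mulr0 big1 // => j _.
  by rewrite gtn_eqF ?mulr0 // (leq_trans (ltn_ord j)).
rewrite (bigD1 (Ordinal lt_i)) //= eqxx mulr1 mulrC big1 ?addr0 // => j.
by rewrite -val_eqE /= eq_sym => /negPf->; rewrite !mulr0.
Qed.

(** * One Kummer step of degree [p]: descent from K(z) to K *)

Section KummerStep.

Variables (K : fieldType) (L : closedFieldType) (iota : {rmorphism K -> L}).
Variables (p r : nat) (z : L) (e w : K).
Hypothesis p_pr : prime p.
Hypothesis r_gt0 : (0 < r)%N.
Hypothesis prim_z : (p ^ r.+1)%N.-primitive_root z.
Hypothesis Dw : iota w = z ^+ p.
Hypothesis De : iota e = z ^+ (p ^ r).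
Hypothesis w_npow : forall c : K, c ^+ p <> w.
Hypothesis sqrtN1 : p = 2%N -> exists i : K, i ^+ 2 = -1.

Local Notation "f ^@" := (map_poly iota f) (at level 2, format "f ^@").
Local Notation eps := (iota e).

Lemma eps_prim : p.-primitive_root eps.
Proof.
have := prim_z; rewrite expnS => /dvdn_prim_root/(_ _ (dvdn_mulr _ (dvdnn p))).
by rewrite mulKn ?prime_gt0 // -De.
Qed.

Lemma eps_conj i : (eps ^+ i * z) ^+ p = iota w.
Proof.
by rewrite exprMn exprAC (prim_expr_order eps_prim) expr1n mul1r Dw.
Qed.

Lemma Xpw_root y : y ^+ p = iota w -> root ('X^p - w%:P)^@ y.
Proof.
by move=> Dy; rewrite rmorphB /= map_polyXn map_polyC /root !hornerE Dy subrr.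
Qed.

(** This is the irreducibility of ['X^p - w]: by the constant term argument with exponent [p ^ 1], a
    nonzero [q] would yield a [p]-th root of [w] in [K]. *)
Lemma low_degree_vanish (q : {poly K}) :
  (size q <= p)%N -> q^@.[z] = 0 -> q = 0.
Proof.
move=> sz_q qz0; apply/eqP/contraT => q_neq0.
have := @low_degree_root_power K L iota p 1 w z q p_pr.
rewrite expn1 => /(_ (esym Dw) q_neq0 sz_q); case; first exact/rootP.
by move=> c /w_npow.
Qed.

(** This makes the automorphism sigma well defined on values at [z]: a polynomial vanishing at [z]
    is a multiple of ['X^p - w]. *)
Lemma conj_vanish (q : {poly K}) y :
  q^@.[z] = 0 -> y ^+ p = iota w -> q^@.[y] = 0.
Proof.
move=> qz0 Dy; have p_gt0 := prime_gt0 p_pr.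
rewrite -(horner_map_modp _ (Xpw_root Dy)).
rewrite (@low_degree_vanish (q %% ('X^p - w%:P))) ?rmorph0 ?horner0 //.
  rewrite -ltnS -(size_XnsubC w p_gt0) ltn_modp -size_poly_eq0 size_XnsubC //.
by rewrite horner_map_modp //; exact/Xpw_root/esym/Dw.
Qed.

Lemma horner_comp_eps (h : {poly K}) i y :
  (h \Po (e ^+ i *: 'X))^@.[y] = h^@.[eps ^+ i * y].
Proof.
rewrite map_comp_poly horner_comp map_polyZ map_polyX hornerZ hornerX.
by rewrite rmorphXn.
Qed.

(** Let [g] be [h] reduced modulo ['X^p - w]. Invariance forces [g(eX) = g(X)], so the coefficient
    of degree [i] is fixed by multiplication by [e ^+ i], which differs from 1 for [0 < i < p]; only
    the constant term survives. *)
Lemma fixed_in_base (h : {poly K}) :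
  h^@.[eps * z] = h^@.[z] -> exists c : K, iota c = h^@.[z].
Proof.
move=> h_fix; have p_gt0 := prime_gt0 p_pr.
have zw0 := Xpw_root (esym Dw).
have ezw0 : root ('X^p - w%:P)^@ (eps * z).
  by apply: Xpw_root; rewrite -[eps]expr1 eps_conj.
pose g := h %% ('X^p - w%:P).
have sz_g : (size g <= p)%N.
  rewrite -ltnS -(size_XnsubC w p_gt0) ltn_modp -size_poly_eq0 size_XnsubC //.
have gE : g \Po (e *: 'X) = g.
  apply/eqP; rewrite -subr_eq0; apply/eqP/low_degree_vanish.
    apply/leq_sizeP => i le_pi.
    rewrite coefB coef_comp_scaleX.
    by rewrite nth_default ?mulr0 ?subrr ?(leq_trans sz_g).
  rewrite rmorphB /= hornerD hornerN -[e]expr1 horner_comp_eps expr1.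
  by rewrite !horner_map_modp // h_fix subrr.
exists g`_0; rewrite -(horner_map_modp h zw0) -/g.
rewrite [g in g^@](_ : _ = (g`_0)%:P) ?map_polyC ?hornerC //.
apply/polyP => -[|i]; rewrite coefC //=.
have [lt_ip | le_pi] := ltnP i.+1 p; last first.
  by rewrite nth_default ?(leq_trans sz_g).
have := congr1 (fun q : {poly K} => q`_i.+1) gE.
rewrite /= coef_comp_scaleX -[RHS]mul1r => /eqP.
rewrite -subr_eq0 -mulrBl mulf_eq0 => /orP[|/eqP //].
rewrite subr_eq0 -(inj_eq (fmorph_inj iota)) rmorphXn rmorph1 /=.
by rewrite -(prim_order_dvd eps_prim) gtnNdvd.
Qed.

(* The norm of g(z) from K(z) down to K: the conjugates of z are eps^i z. *)
Definition norm (g : {poly K}) : L := \prod_(i < p) g^@.[eps ^+ i * z].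

Lemma prod_eps_shift (F : L -> L) :
  \prod_(i < p) F (eps ^+ i.+1) = \prod_(i < p) F (eps ^+ i).
Proof.
have := prim_expr_order eps_prim; case: (p) (prime_gt0 p_pr) => // n _ e1.
by rewrite big_ord_recr [RHS]big_ord_recl /= e1 expr0 mulrC.
Qed.

Lemma norm_in_base g : exists c : K, iota c = norm g.
Proof.
pose h := \prod_(i < p) (g \Po (e ^+ i *: 'X)).
have hE y : h^@.[y] = \prod_(i < p) g^@.[eps ^+ i * y].
  rewrite rmorph_prod horner_prod; apply: eq_bigr => i _.
  exact: horner_comp_eps.
rewrite /norm -hE; apply: fixed_in_base; rewrite !hE.
under eq_bigr => i _ do rewrite mulrA -exprSr.
exact: (prod_eps_shift (fun x => g^@.[x * z])).
Qed.

Lemma normXn g n : norm (g ^+ n) = norm g ^+ n.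
Proof.
by rewrite -prodrXl; apply: eq_bigr => i _; rewrite rmorphXn horner_exp.
Qed.

Lemma eq_norm g h : g^@.[z] = h^@.[z] -> norm g = norm h.
Proof.
move=> eq_gh; apply: eq_bigr => i _; apply/eqP; rewrite -subr_eq0.
rewrite -hornerN -hornerD -rmorphB; apply/eqP/conj_vanish; last exact: eps_conj.
by rewrite rmorphB hornerD hornerN eq_gh subrr.
Qed.

Lemma normX : norm 'X = (\prod_(i < p) eps ^+ i) * iota w.
Proof.
rewrite /norm; under eq_bigr => i _ do rewrite map_polyX hornerX.
by rewrite big_split /= prodr_const card_ord Dw.
Qed.

Lemma prod_eps_odd : odd p -> \prod_(i < p) eps ^+ i = 1.
Proof.
move=> p_odd; rewrite prodrXr -(big_mkord xpredT (fun i => i)).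
rewrite bin2_sum bin2odd //.
by rewrite exprM (prim_expr_order eps_prim) expr1n.
Qed.

Lemma eps_eqN1 : p = 2%N -> eps = -1.
Proof.
move=> p2; have := prim_expr_order eps_prim; rewrite p2 => /eqP.
rewrite sqrf_eq1 => /orP[/eqP e1 | /eqP //].
have := prim_order_dvd eps_prim 1; rewrite e1 expr1n eqxx dvdn1.
by rewrite p2.
Qed.

Lemma prod_eps_even : p = 2%N -> \prod_(i < p) eps ^+ i = -1.
Proof.
move=> p2; under eq_bigr => j _ do rewrite eps_eqN1 //.
by rewrite p2 !big_ord_recl big_ord0 expr0 mul1r mulr1.
Qed.

(** Up to a [p]-th power of [K], the norm of [z] is [w]: for [p = 2] it is [-w], and [-1] is a
    square in [K]. *)
Lemma normX_power_base : exists t : K, norm 'X = iota (t ^+ p * w).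
Proof.
case: (even_prime p_pr) => [p2 | p_odd]; last first.
  by exists 1; rewrite normX prod_eps_odd // expr1n mul1r mul1r.
have [i i2] := sqrtN1 p2; exists i; rewrite normX prod_eps_even //.
by rewrite p2 i2 mulN1r mulN1r rmorphN.
Qed.

Lemma root_of_unity_bound (g : {poly K}) (s : nat) :
  g^@.[z] ^+ (p ^ s) = 1 -> g^@.[z] ^+ (p ^ r.+1) = 1.
Proof.
elim: s g => [|s IHs] g g1.
  by rewrite expn0 expr1 in g1; rewrite g1 expr1n.
have p_gt0 := prime_gt0 p_pr.
(* The induction hypothesis for [g ^+ p] leaves one factor [p] in excess. *)
have gp1 : g^@.[z] ^+ (p ^ r.+2) = 1.
  have := IHs (g ^+ p); rewrite rmorphXn horner_exp -!exprM -!expnS.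
  exact.
have [j Dj] : exists j, g^@.[z] ^+ p = z ^+ j.
  rewrite expnS exprM in gp1.
  by have [j ->] := prim_rootP prim_z gp1; exists j.
have [/dvdnP[k Dk] | p_ndvd_j] := boolP (p %| j)%N.
  rewrite expnS exprM Dj -exprM Dk -mulnA -expnS mulnC exprM.
  by rewrite (prim_expr_order prim_z) expr1n.
(* If [p] does not divide [j], taking norms in [g(z)^p = z^j] makes [w ^+ j], and hence [w], a
   [p]-th power in [K], a contradiction. *)
have [t Dt] := normX_power_base; have [c Dc] := norm_in_base g.
have norm_p : norm g ^+ p = norm 'X ^+ j.
  rewrite -!normXn; apply: eq_norm.
  by rewrite !rmorphXn /= map_polyX !hornerE Dj.
have t_neq0 : t ^+ p != 0.
  apply: contraTneq isT => t0; have := normX; rewrite Dt t0 mul0r rmorph0.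
  move/esym/eqP; rewrite Dw mulf_eq0 prodf_seq_eq0 => /orP[/hasP[i _ /=]|].
    by rewrite expf_eq0 (prim_root_eq0 eps_prim) gtn_eqF // andbF.
  by rewrite expf_eq0 (prim_root_eq0 prim_z) expn_eq0 gtn_eqF // !andbF.
have cj : (c / t ^+ j) ^+ p = w ^+ j.
  apply: (mulfI (expf_neq0 j t_neq0)); rewrite -exprMn expr_div_n -!exprM.
  rewrite [(j * p)%N]mulnC mulrCA divff ?mulr1; last by rewrite exprM expf_neq0.
  by apply: (fmorph_inj iota); rewrite !rmorphXn /= Dc norm_p Dt.
have j_gt0 : (0 < j)%N by case: (j) p_ndvd_j => //; rewrite dvdn0.
have [|d /w_npow//] := coprime_exp_root j_gt0 p_gt0 _ cj.
by rewrite coprime_sym prime_coprime.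
Qed.

Lemma norm1_exp (j : nat) : norm 'X ^+ j = 1 -> exists l, z ^+ j = eps ^+ l.
Proof.
move=> Nj1; suff wj : (z ^+ p) ^+ j = 1.
  have : (p ^ r %| j)%N.
    have := prim_order_dvd prim_z (p * j); rewrite exprM wj eqxx expnS.
    by rewrite dvdn_pmul2l ?prime_gt0.
  by case/dvdnP=> l ->; exists l; rewrite De -exprM mulnC.
case: (even_prime p_pr) => [p2 | p_odd]; last first.
  by move: Nj1; rewrite normX prod_eps_odd // mul1r Dw.
(* For [p = 2], [r = 1] would give [w = eps = -1], a square in [K]. So 8 divides the order of [z];
   squaring [(-w)^j = 1] gives [z^(4j) = 1], whence [j] is even and the sign disappears. *)
have r_gt1 : (1 < r)%N.
  have [i i2] := sqrtN1 p2; rewrite ltn_neqAle r_gt0 andbT; apply/eqP => r1.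
  apply: (w_npow (c := i)); apply: (fmorph_inj iota).
  by rewrite p2 i2 rmorphN1 -(eps_eqN1 p2) De Dw -r1 expn1.
move: Nj1; rewrite normX prod_eps_even // mulN1r Dw => Nj1.
suff j_even : ~~ odd j by rewrite -Nj1 exprNn -signr_odd (negPf j_even) mul1r.
have : z ^+ (4 * j) = 1.
  have := congr1 (fun x => x ^+ 2) Nj1.
  rewrite /= expr1n exprAC sqrrN => <-; rewrite -!exprM p2.
  by rewrite mulnA.
move/eqP; rewrite -(prim_order_dvd prim_z) p2 => dvd4j.
rewrite -dvdn2 -(@dvdn_pmul2l 4) //.
by apply: dvdn_trans dvd4j; apply: (@dvdn_exp2l 2 3).
Qed.

Lemma kummer_step_descent (s : nat) (a : K) (f : {poly K}) :
  (r < s)%N -> f^@.[z] ^+ (p ^ s) = iota a -> exists d : K, d ^+ (p ^ s) = a.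
Proof.
move=> lt_rs Df; set n := (p ^ s)%N in Df *.
have n_gt0 : (0 < n)%N by rewrite expn_gt0 prime_gt0.
have [-> | a_neq0] := eqVneq a 0; first by exists 0; rewrite expr0n gtn_eqF.
have ia_neq0 : iota a != 0 by rewrite fmorph_eq0.
have conj_n y : y ^+ p = iota w -> f^@.[y] ^+ n = iota a.
  move=> Dy; apply/eqP; rewrite -subr_eq0.
  have: (f ^+ n - a%:P)^@.[y] = 0.
    apply: conj_vanish Dy; rewrite rmorphB rmorphXn /= map_polyC !hornerE.
    by rewrite Df subrr.
  by rewrite rmorphB rmorphXn /= map_polyC !hornerE => ->.
(* A polynomial whose value at [z] is xi = sigma(b)/b for [b = f(z)]: since [b ^+ n = a], the
   inverse of [b] is [b ^+ n.-1 / a]. *)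
pose g := a^-1 *: ((f \Po (e ^+ 1 *: 'X)) * f ^+ n.-1).
have gE y : g^@.[y] = (iota a)^-1 * (f^@.[eps * y] * f^@.[y] ^+ n.-1).
  rewrite map_polyZ rmorphM rmorphXn /= hornerZ hornerM horner_comp_eps.
  by rewrite horner_exp expr1 fmorphV.
have fepsE : f^@.[eps * z] = g^@.[z] * f^@.[z].
  by rewrite gE -!mulrA -exprSr prednK // Df mulrCA mulVf // mulr1.
have Ng1 : norm g = 1.
  (* Shifting the index in the factors [f(eps y)] turns each factor of the norm into
     [f(y)^n / a = 1]. *)
  rewrite /norm; under eq_bigr => i _ do rewrite gE mulrA -exprS mulrCA.
  rewrite big_split /= (prod_eps_shift (fun x => f^@.[x * z])) -big_split /=.
  rewrite big1 // => i _; rewrite mulrCA -exprS prednK // conj_n ?eps_conj //.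
  by rewrite mulVf.
have gn1 : g^@.[z] ^+ n = 1.
  apply: (mulIf ia_neq0); rewrite mul1r -[in LHS]Df -exprMn -fepsE conj_n //.
  by rewrite -[eps]expr1 eps_conj.
have [j Dj] := prim_rootP prim_z (root_of_unity_bound gn1).
have [|l Dl] := @norm1_exp j.
  rewrite -normXn -Ng1; apply: eq_norm.
  by rewrite rmorphXn /= map_polyX !hornerE Dj.
(* m stands for -l modulo the order of z. *)
pose m := ((p ^ r.+1).-1 * l)%N.
have q_gt0 : (0 < p ^ r.+1)%N by rewrite expn_gt0 prime_gt0.
have epsm : eps ^+ l * eps ^+ m = 1.
  rewrite -exprD -mulSn prednK // expnS -mulnA exprM.
  by rewrite (prim_expr_order eps_prim) expr1n.
have [c Dc] : exists c, iota c = (f * 'X^m)^@.[z].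
  apply: fixed_in_base; rewrite !rmorphM /= !map_polyXn !hornerE fepsE Dj Dl.
  by rewrite exprMn mulrACA epsm mul1r.
exists c; apply: (fmorph_inj iota).
rewrite rmorphXn /= Dc rmorphM /= map_polyXn !hornerE exprMn Df.
rewrite -exprM mulnC exprM /n -(subnK lt_rs) expnD mulnC exprM.
by rewrite (prim_expr_order prim_z) !expr1n mulr1.
Qed.

End KummerStep.

(** * Climbing down the cyclotomic tower *)

(** Realises K(z) as a field in its own right, so that it can be the base of a Kummer step. *)
Lemma simple_extension (K L : fieldType) (iota : {rmorphism K -> L}) (z : L)
    (q : {poly K}) :
  q != 0 -> root (map_poly iota q) z ->
  exists (M : fieldType) (i : {rmorphism K -> M}) (j : {rmorphism M -> L}),
    [/\ forall x, j (i x) = iota x, exists x0, j x0 = z &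
        forall x, exists f : {poly K}, j x = (map_poly iota f).[z]].
Proof.
move=> q_neq0 qz0.
exists (subFExtend iota z q), (inj_subfx iota z q), (subfx_inj (p := q)).
split=> [x||x].
- by rewrite /= subfx_inj_eval // map_polyC hornerC.
- by exists (subfx_root iota z q); apply: subfx_inj_root.
- by have [f ->] := subfxE x; exists f; apply: (subfx_inj_eval qz0 q_neq0).
Qed.

Lemma cyclotomic_descent (L : closedFieldType) (p : nat) :
  prime p -> forall (r s : nat) (K : fieldType) (iota : {rmorphism K -> L})
    (z : L) (a : K) (f : {poly K}),
  (p = 2%N -> exists i : K, i ^+ 2 = -1) -> (r < s)%N ->
  (p ^ r.+1)%N.-primitive_root z ->
  (map_poly iota f).[z] ^+ (p ^ s) = iota a -> exists d, d ^+ (p ^ s) = a.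
Proof.
move=> p_pr; have p_gt1 := prime_gt1 p_pr; have p_gt0 := prime_gt0 p_pr.
elim=> [|r IHr] s K iota z a f sqrtN1 lt_rs prim_z Df.
  (* [1 + X + ... + X^(p-1)] has degree [p - 1], so [f(z)] is killed in degree below [p]. *)
  pose m : {poly K} := \poly_(i < p) 1.
  have sz_m : size m = p by rewrite size_poly_eq ?oner_neq0.
  have mz0 : root (map_poly iota m) z.
    have z_neq1 : z != 1.
      by rewrite -[z]expr1 -(prim_order_dvd prim_z) expn1 dvdn1 gtn_eqF.
    have mE : (map_poly iota m).[z] = \sum_(i < p) z ^+ i.
      rewrite (horner_coef_wide (n := p)) ?size_map_poly ?sz_m //.
      apply: eq_bigr => i _.
      by rewrite coef_map coef_poly ltn_ord /= rmorph1 mul1r.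
    have /eqP := subrX1 z p.
    rewrite -[p in z ^+ p]expn1 (prim_expr_order prim_z) subrr eq_sym mulf_eq0.
    by rewrite subr_eq0 (negPf z_neq1) -mE.
  have [|q [q_neq0]] := poly_value_annihilator f _ mz0; first by rewrite sz_m.
  rewrite sz_m; exact: low_degree_root_power p_pr Df q_neq0.
have zp_prim : (p ^ r.+1)%N.-primitive_root (z ^+ p).
  have := prim_z; rewrite [(p ^ r.+2)%N]expnSr.
  move=> /dvdn_prim_root/(_ _ (dvdn_mulr _ (dvdnn (p ^ r.+1)))).
  by rewrite mulKn // expn_gt0 p_gt0.
pose Q : {poly K} := 'X^(p ^ r.+1) - 1.
have Q_neq0 : Q != 0.
  by rewrite -size_poly_eq0 size_Xn_sub_1 // expn_gt0 p_gt0.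
have Qz0 : root (map_poly iota Q) (z ^+ p).
  rewrite rmorphB rmorph1 /= map_polyXn /root !hornerE.
  by rewrite (prim_expr_order zp_prim) subrr.
have [M [i [j [ji [w Dw] Mpoly]]]] := simple_extension Q_neq0 Qz0.
have [d Dd] : exists d : M, d ^+ (p ^ s) = i a.
  pose fM := map_poly i f.
  have fME x : (map_poly j fM).[x] = (map_poly iota f).[x].
    by rewrite -map_poly_comp; congr (_.[x]); apply: eq_map_poly.
  have DfM : (map_poly j fM).[z] ^+ (p ^ s) = j (i a) by rewrite fME ji.
  have De : j (w ^+ (p ^ r)) = z ^+ (p ^ r.+1).
    by rewrite rmorphXn Dw -exprM expnS.
  (* If [w = c ^+ p] in [M], then [z] is [c] times a power of [z ^+ (p ^ r.+1)], which is the image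
     of [w ^+ (p ^ r)]. So [z] already comes from [M], and [d] is the value of [f] there. *)
  have [[c Dc] | w_npow] := pselect (exists c : M, c ^+ p = w).
    have eps_prim : p.-primitive_root (z ^+ (p ^ r.+1)).
      have := prim_z; rewrite [(p ^ r.+2)%N]expnS.
      move=> /dvdn_prim_root/(_ _ (dvdn_mulr _ (dvdnn p))).
      by rewrite mulKn.
    have c_neq0 : j c != 0.
      have : z ^+ p != 0.
        by rewrite expf_eq0 (prim_root_eq0 prim_z) expn_eq0 gtn_eqF // !andbF.
      by apply: contra_neq => c0; rewrite -Dw -Dc rmorphXn /= c0 expr0n gtn_eqF.
    have : (z / j c) ^+ p = 1.
      by rewrite expr_div_n -rmorphXn Dc Dw divff // -Dw -Dc rmorphXn expf_neq0.
    case/(prim_rootP eps_prim)=> k /(canRL (divfK c_neq0)) Dz.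
    exists (fM.[w ^+ (p ^ r) ^+ k * c]); apply: (fmorph_inj j).
    by rewrite -DfM Dz rmorphXn -horner_map /= rmorphM rmorphXn De.
  apply: (kummer_step_descent p_pr (ltn0Sn r) prim_z Dw De _ _ lt_rs DfM).
    by move=> c Dc; apply: w_npow; exists c.
  by move=> /sqrtN1[x x2]; exists (i x); rewrite -rmorphXn x2 rmorphN1.
have [g Dg] := Mpoly d.
apply: (IHr s K iota (z ^+ p) a g) => //; first exact: ltnW.
by rewrite -Dg -rmorphXn Dd ji.
Qed.

(** The image of the abstract K(z) is a subfield containing K and [z], so it contains the smallest
    one. *)
Lemma adjoin_poly (K L : fieldType) (iota : {rmorphism K -> L}) (z : L)
    (q : {poly K}) :
  q != 0 -> root (map_poly iota q) z ->
  forall x, adjoin iota z x -> exists f : {poly K}, x = (map_poly iota f).[z].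
Proof.
move=> q_neq0 qz0 x adj_x.
have [M [i [j [ji [z0 Dz] Mpoly]]]] := simple_extension q_neq0 qz0.
suff [y _ <-] : range j x by have [f ->] := Mpoly y; exists f.
apply: adj_x; split.
  split=> [|x1 x2|x1 x2]; rewrite !inE.
  - by exists 1; rewrite ?rmorph1.
  - by move=> [y1 _ <-] [y2 _ <-]; exists (y1 - y2); rewrite ?rmorphB.
  - by move=> [y1 _ <-] [y2 _ <-]; exists (y1 / y2); rewrite ?fmorph_div.
by move=> _ [[y _ <-]|->]; [exists (i y) | exists z0].
Qed.

Local Open Scope classical_set_scope.

Theorem theorem3p2
  (K : fieldType) (Kbar : closedFieldType) (iota : {rmorphism K -> Kbar})
  (hKbar : is_algebraic_closure iota)
  (p : nat) (hp : prime p) (hchar : p \notin [pchar K])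
  (hi : p = 2%N -> exists i : K, i ^+ 2 = -1)
  (r s : nat) (hr : (1 <= r)%N) (hrs : (r <= s)%N)
  (zeta : Kbar) (hzeta : (p ^ r)%N.-primitive_root zeta) :
  (forall alpha : K,
     powers (adjoin iota zeta) (p ^ s) (iota alpha) ->
     powers [set: K] (p ^ s) alpha) /\
  powers (adjoin iota zeta) (p ^ s) `&` range iota =
    powers (range iota) (p ^ s).
Proof.
have descent alpha : powers (adjoin iota zeta) (p ^ s) (iota alpha) ->
    powers [set: K] (p ^ s) alpha.
  case: r hr hrs hzeta => // r' _ lt_rs prim_z [b adj_b Db].
  have q_gt0 : (0 < p ^ r'.+1)%N by rewrite expn_gt0 prime_gt0.
  have Q_neq0 : 'X^(p ^ r'.+1) - 1 != 0 :> {poly K}.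
    by rewrite -size_poly_eq0 size_Xn_sub_1.
  have Qz0 : root (map_poly iota ('X^(p ^ r'.+1) - 1)) zeta.
    rewrite rmorphB rmorph1 /= map_polyXn /root !hornerE.
    by rewrite (prim_expr_order prim_z) subrr.
  have [f Df] := adjoin_poly Q_neq0 Qz0 adj_b.
  have [|d Dd] := cyclotomic_descent hp (iota := iota) (a := alpha) (f := f)
    hi lt_rs prim_z.
    by rewrite -Df.
  by exists d.
split=> //; apply/seteqP; split=> [x [pow_x [a _ Da]]|_ [_ [b _ <-] <-]].
  move: pow_x; rewrite -Da => /descent[b _ <-].
  by exists (iota b); [exists b | rewrite rmorphXn].
split; last by exists (b ^+ (p ^ s)); rewrite ?rmorphXn.
by exists (iota b) => //; apply: sub_gen_smallest; left; exists b.
Qed.
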